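(* Let $\lambda=(\lambda_1,\lambda_2,\lambda_3,\lambda_4,\lambda_5,\lambda_6,\lambda_6,-\lambda_6)$ be a highest weight (for $\mathfrak{e}_6$) with $(\lambda_1,\lambda_2,\lambda_3,\lambda_4)\neq(0,0,0,0)$ such that the strict basic Dirac inequality $\|(\lambda-s_1)^{+}+\rho\|^2>\|\lambda+\rho\|^2$ holds. Then $$\|(\lambda-s_{a,b})^{+}+\rho\|^2-\|\lambda+\rho\|^2>0\qquad\text{for all } a,b\in\mathbb{N}_0,\ (a,b)\neq(0,0).$$
   Context: Setting for $\mathfrak{e}_6$ (Hermitian case). Work in $\mathbb{R}^8$ with the standard inner product $\langle\cdot,\cdot\rangle$ and norm $\|\cdot\|$, and let $\mathbb{N}_0=\{0,1,2,\dots\}$. Put $\rho=(0,1,2,3,4,-4,-4,4)$. The group $W_{\mathfrak{k}}$ is generated by the reflections $s_\alpha(\mu)=\mu-\frac{2\langle\mu,\alpha\rangle}{\langle\alpha,\alpha\rangle}\alpha$ for $\alpha=\varepsilon_i\pm\varepsilon_j$, $5\ge i>j\ge 1$, where $\varepsilon_i$ is the $i$-th coordinate functional, identified with the $i$-th standard basis vector; so $W_{\mathfrak{k}}$ permutes the first five coordinates and changes an even number of their signs. For $\mu\in\mathbb{R}^8$, $\mu^{+}$ denotes the unique $W_{\mathfrak{k}}$-conjugate of $\mu$ satisfying $|\mu_1|\le\mu_2\le\mu_3\le\mu_4\le\mu_5$. A highest weight is a real vector $\lambda=(\lambda_1,\lambda_2,\lambda_3,\lambda_4,\lambda_5,\lambda_6,\lambda_6,-\lambda_6)$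 with $|\lambda_1|\le\lambda_2\le\lambda_3\le\lambda_4\le\lambda_5$ and $\lambda_i-\lambda_j\in\mathbb{Z}$, $2\lambda_i\in\mathbb{Z}$ for $i,j\in\{1,\dots,5\}$. The basic Schmid modules are (represented by) $s_1=\frac12(1,1,1,1,1,-1,-1,1)$ and $s_2=(0,0,0,0,1,-1,-1,1)$. A general Schmid module is $s_{a,b}=a s_1+b s_2$ with $a,b\in\mathbb{N}_0$, $a+b>0$. *)

(* Defs.v *)
From HB Require Import structures.
From mathcomp Require Import all_boot all_order all_algebra perm.
From mathcomp Require Import zify ring lra.
From mathcomp Require Import boolp classical_sets reals.

Set Implicit Arguments.
Unset Strict Implicit.
Unset Printing Implicit Defensive.

Import Order.TTheory GRing.Theory Num.Theory.
Local Open Scope ring_scope.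

Section Setting.
Variable R : realType.
Implicit Types (mu nu x y alpha : 'rV[R]_8) (w : 'rV[R]_8 -> 'rV[R]_8).

(* Coordinates are numbered from 1 to 8, whereas 'I_8 starts at 0. *)
Definition coord8 mu (i : nat) : R := mu 0 (inord i.-1).

Definition eps (i : nat) : 'rV[R]_8 := delta_mx 0 (inord i.-1).

Definition vec8 (s : seq R) : 'rV[R]_8 := \row_(i < 8) s`_i.

Definition dot x y : R := \sum_(i < 8) x 0 i * y 0 i.

Definition norm8 x : R := Num.sqrt (dot x x).

Definition rho : 'rV[R]_8 := vec8 [:: 0; 1; 2; 3; 4; - 4; - 4; 4].

Definition refl alpha mu : 'rV[R]_8 :=
  mu - (2 * dot mu alpha / dot alpha alpha) *: alpha.

Definition compact_root alpha : Prop :=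
  exists i j : nat, [/\ (1 <= j)%N, (j < i)%N, (i <= 5)%N &
    alpha = eps i + eps j \/ alpha = eps i - eps j].

(* Reflections are involutions, so their finite composites form a group. *)
Inductive in_Wk : ('rV[R]_8 -> 'rV[R]_8) -> Prop :=
| Wk_id : in_Wk id
| Wk_refl alpha w : compact_root alpha -> in_Wk w -> in_Wk (refl alpha \o w).

Definition Wk_conj mu nu : Prop := exists2 w, in_Wk w & nu = w mu.

Definition k_dominant mu : Prop :=
  [/\ `|coord8 mu 1| <= coord8 mu 2, coord8 mu 2 <= coord8 mu 3,
      coord8 mu 3 <= coord8 mu 4 & coord8 mu 4 <= coord8 mu 5].

(* The default value of [xget] is never used: see [dom_conjP]. *)
Definition dom_conj mu : 'rV[R]_8 :=
  xget mu [set nu | Wk_conj mu nu /\ k_dominant nu]%classic.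

Lemma coord8E mu (k : 'I_8) : mu 0 k = coord8 mu k.+1.
Proof. by rewrite /coord8 /= inord_val. Qed.

Lemma refl_entry (p q : 'I_8) (s : R) mu (k : 'I_8) : p != q -> s ^+ 2 = 1 ->
  refl (delta_mx 0 p + s *: delta_mx 0 q) mu 0 k =
  (if (k == p) || (k == q) then - s else 1) * mu 0 (tperm p q k).
Proof.
move=> pq ss; have qp : (q == p) = false by rewrite eq_sym (negbTE pq).
have dotE x : dot x (delta_mx 0 p + s *: delta_mx 0 q) = x 0 p + s * x 0 q.
  rewrite /dot (bigD1 p) //= (bigD1 q) ?qp //= big1 ?addr0.
    by rewrite !mxE !eqxx qp (negbTE pq) /=; ring.
  move=> i /andP[ip iq]; rewrite !mxE (negbTE ip) (negbTE iq) andbF /=; ring.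
rewrite /refl !dotE !mxE !eqxx qp (negbTE pq) /=.
have -> : 1%:R + s * 0%:R + s * (0%:R + s * 1%:R) = 2 :> R.
  by rewrite ?mulr1n ?mulr0n mulr0 addr0 add0r mulr1 -expr2 ss.
rewrite [2 * _]mulrC mulfK ?pnatr_eq0 //.
have [->|kp] := eqVneq k p.
  by rewrite tpermL (negbTE pq) /=; ring.
have [->|kq] := eqVneq k q.
  rewrite tpermR /=.
  transitivity (mu 0 q - s * mu 0 p - s ^+ 2 * mu 0 q); first by ring.
  by rewrite ss; ring.
by rewrite tpermD 1?eq_sym //=; ring.
Qed.

Lemma rootE alpha : compact_root alpha ->
  exists p q : 'I_8, exists s : bool, [/\ (p < 5)%N, (q < 5)%N, p != q &
    forall mu k, refl alpha mu 0 k =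
      (if (k == p) || (k == q) then (-1) ^+ s else 1) * mu 0 (tperm p q k)].
Proof.
move=> [i [j [j1 ji i5 alphaE]]].
have pE : (inord i.-1 : 'I_8) = i.-1 :> nat by rewrite inordK //; lia.
have qE : (inord j.-1 : 'I_8) = j.-1 :> nat by rewrite inordK //; lia.
have pq : (inord i.-1 : 'I_8) != inord j.-1.
  by apply/eqP => /(congr1 (@nat_of_ord _)); rewrite pE qE; lia.
exists (inord i.-1), (inord j.-1); case: alphaE => ->.
  exists true; split; [by rewrite pE; lia|by rewrite qE; lia|by []|].
  by move=> mu k; rewrite -(scale1r (eps j)) refl_entry ?expr1n.
exists false; split; [by rewrite pE; lia|by rewrite qE; lia|by []|].
by move=> mu k; rewrite -scaleN1r refl_entry ?sqrrN ?expr1n // opprK.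
Qed.

Lemma conj_refl mu nu alpha :
  compact_root alpha -> Wk_conj mu nu -> Wk_conj mu (refl alpha nu).
Proof.
by move=> ra [w ww ->]; exists (refl alpha \o w) => //; exact: Wk_refl.
Qed.

Definition signed_perm mu (x : {perm 'I_8} * {ffun 'I_8 -> bool}) : 'rV[R]_8 :=
  \row_k ((-1) ^+ x.2 k * mu 0 (x.1 k)).

Lemma conj_signed_perm mu nu : Wk_conj mu nu -> exists u, nu = signed_perm mu u.
Proof.
move=> [w + ->]; elim => [|alpha w' ra _ [[s e] /= IH]].
  exists (1%g, [ffun=> false]); apply/rowP => k.
  by rewrite mxE /= ffunE perm1 mul1r.
have [p [q [b [_ _ _ rE]]]] := rootE ra.
exists ((tperm p q * s)%g,
  [ffun k => (((k == p) || (k == q)) && b) (+) e (tperm p q k)]).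
apply/rowP => k; rewrite rE IH !mxE /= ffunE permM signr_addb mulrA.
by case: ifP.
Qed.

Lemma dom_conj_exists mu : exists nu, Wk_conj mu nu /\ k_dominant nu.
Proof.
pose h nu : R := coord8 nu 2 + 2 * coord8 nu 3 + 3 * coord8 nu 4
  + 4 * coord8 nu 5.
have mumu : Wk_conj mu mu by exists id => //; exact: Wk_id.
have [x0 x0E] := conj_signed_perm mumu.
pose P u := `[< Wk_conj mu (signed_perm mu u) >].
have Px0 : P x0 by apply/asboolP; rewrite -x0E.
case: (@arg_maxP _ _ _ x0 P (fun u => h (signed_perm mu u)) Px0).
move=> x /asboolP Px xmax; exists (signed_perm mu x); split=> //.
move: (signed_perm mu x) Px xmax => nu cnu numax.
have hmax alpha : compact_root alpha -> h (refl alpha nu) <= h nu.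
  move=> ra; have cr := conj_refl ra cnu.
  have [y yE] := conj_signed_perm cr.
  by rewrite yE; apply: numax; apply/asboolP; rewrite -yE.
have D i : (0 < i < 5)%N -> compact_root (eps i.+1 - eps i).
  by move=> i5; exists i.+1, i; split; try lia; right.
have S : compact_root (eps 2 + eps 1).
  by exists 2%N, 1%N; split => //; left.
have ordE (i j : nat) : (i < 8)%N -> (j < 8)%N ->
    ((inord i : 'I_8) == inord j) = (i == j).
  by move=> i8 j8; rewrite -val_eqE /= !inordK.
have cD i k : (0 < i < 5)%N -> (k < 8)%N ->
    coord8 (refl (eps i.+1 - eps i) nu) k.+1 =
    if k == i then coord8 nu i else if k == i.-1 then coord8 nu i.+1
    else coord8 nu k.+1.
  move=> i5 k8; rewrite /coord8 /eps -scaleN1r refl_entry ?sqrrN ?expr1n //.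
    rewrite opprK if_same mul1r permE /= !ordE //=; try lia.
    by case: eqP => // _; case: eqP.
  by rewrite ordE /=; lia.
have cS k : (k < 8)%N -> coord8 (refl (eps 2 + eps 1) nu) k.+1 =
    if k == 1%N then - coord8 nu 1 else if k == 0%N then - coord8 nu 2
    else coord8 nu k.+1.
  move=> k8; rewrite /coord8 /eps -(scale1r (delta_mx _ (inord 1.-1))).
  rewrite refl_entry ?expr1n ?ordE // permE /= !ordE //=.
  case: eqP => _ /=; first by rewrite mulN1r.
  by case: eqP => _ /=; rewrite ?mulN1r ?mul1r.
have hD i : (0 < i < 5)%N -> coord8 nu i <= coord8 nu i.+1.
  move=> i5; have := hmax _ (D i i5).
  rewrite /h (cD i 1%N) // (cD i 2) // (cD i 3) // (cD i 4) //.
  by case: i i5 => [|[|[|[|[|i]]]]] //= _; lra.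
have := hmax _ S; rewrite /h (cS 1%N) // (cS 2) // (cS 3) // (cS 4) //= => h0.
have h1 := hD 1%N isT; have h2 := hD 2 isT.
have h3 := hD 3 isT; have h4 := hD 4 isT.
by split; [rewrite ler_norml; apply/andP; split|..]; lra.
Qed.

Lemma conj_invariants mu nu : Wk_conj mu nu ->
  [/\ forall k : 'I_8, (5 <= k)%N -> nu 0 k = mu 0 k,
      forall f : R -> nat, (\sum_(k < 8 | k < 5) f `|nu 0 k|%R =
        \sum_(k < 8 | k < 5) f `|mu 0 k|%R)%N &
      \prod_(k < 8 | (k < 5)%N) nu 0 k = \prod_(k < 8 | (k < 5)%N) mu 0 k].
Proof.
move=> [w + ->]; elim => [//|alpha w' ra _ [I1 I2 I3]].
have [p [q [b [p5 q5 pq rE]]]] := rootE ra.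
have qp : q != p by rewrite eq_sym.
split => [k k5|f|]; rewrite /=.
- have kp : k != p by apply/eqP => kp; move: p5; rewrite -kp; lia.
  have kq : k != q by apply/eqP => kq; move: q5; rewrite -kq; lia.
  by rewrite rE (negbTE kp) (negbTE kq) mul1r tpermD 1?eq_sym // I1.
- rewrite -I2 (bigD1 p) //= (bigD1 q) /= ?q5 //.
  rewrite [RHS](bigD1 p) //= [in RHS](bigD1 q) /= ?q5 //.
  rewrite !rE !eqxx orbT /= tpermL tpermR !normrM normr_sign !mul1r addnCA.
  congr (_ + (_ + _))%N; apply: eq_bigr => k /andP[/andP[_ kp] kq].
  by rewrite rE (negbTE kp) (negbTE kq) mul1r tpermD 1?eq_sym.
- rewrite -I3 (bigD1 p) //= (bigD1 q) /= ?q5 //.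
  rewrite [RHS](bigD1 p) //= [in RHS](bigD1 q) /= ?q5 //.
  rewrite !rE !eqxx orbT /= tpermL tpermR.
  have -> : \prod_(i < 8 | (i < 5)%N && (i != p) && (i != q))
      refl alpha (w' mu) 0 i =
      \prod_(i < 8 | (i < 5)%N && (i != p) && (i != q)) w' mu 0 i.
    apply: eq_bigr => k /andP[/andP[_ kp] kq].
    by rewrite rE (negbTE kp) (negbTE kq) mul1r tpermD 1?eq_sym.
  by case: b {rE}; rewrite ?expr0 ?expr1; ring.
Qed.

Lemma dom_conj_unique mu : exists! nu, Wk_conj mu nu /\ k_dominant nu.
Proof.
have [nu [cnu dnu]] := dom_conj_exists mu.
exists nu; split=> // nu' [cnu' dnu'].
have [I1 I2 I3] := conj_invariants cnu.
have [J1 J2 J3] := conj_invariants cnu'.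
pose l x := [seq `|coord8 x k| | k <- [:: 1; 2; 3; 4; 5]%N].
have countl x (a : pred R) :
    count a (l x) = (\sum_(k < 8 | k < 5) a `|x 0 k|%R)%N.
  by rewrite big_mkcond /= !big_ord_recl big_ord0 /= !coord8E.
have abs_le x : k_dominant x -> sorted <=%R (l x) /\
    [/\ `|coord8 x 2| = coord8 x 2, `|coord8 x 3| = coord8 x 3,
      `|coord8 x 4| = coord8 x 4 & `|coord8 x 5| = coord8 x 5].
  move=> [h1 h2 h3 h4]; have h0 := normr_ge0 (coord8 x 1).
  have E2 : `|coord8 x 2| = coord8 x 2 by apply: ger0_norm; lra.
  have E3 : `|coord8 x 3| = coord8 x 3 by apply: ger0_norm; lra.
  have E4 : `|coord8 x 4| = coord8 x 4 by apply: ger0_norm; lra.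
  have E5 : `|coord8 x 5| = coord8 x 5 by apply: ger0_norm; lra.
  by split; [rewrite /= E2 E3 E4 E5 h1 h2 h3 h4|split].
have [s [n2 n3 n4 n5]] := abs_le _ dnu.
have [s' [n2' n3' n4' n5']] := abs_le _ dnu'.
have ll : l nu = l nu'.
  apply: (sorted_eq le_trans le_anti) => //; apply/seq.permP => a.
  rewrite !countl.
  exact: etrans (I2 (fun r => a r)) (esym (J2 (fun r => a r))).
move: ll; rewrite /l /= n2 n3 n4 n5 n2' n3' n4' n5' => -[e1 e2 e3 e4 e5].
have e1' : coord8 nu 1 = coord8 nu' 1.
  move: I3; rewrite -J3 big_mkcond [RHS]big_mkcond /= !big_ord_recl !big_ord0.
  rewrite /= !coord8E /= -!e2 -!e3 -!e4 -!e5 !mulr1 => prodE.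
  have [z|nz] := eqVneq (coord8 nu 2) 0.
    move: dnu dnu' => [+ _ _ _] [+ _ _ _]; rewrite -e2 z !normr_le0.
    by move=> /eqP-> /eqP->.
  have pos : 0 < coord8 nu 2 by rewrite lt_neqAle eq_sym nz -n2 normr_ge0.
  apply: mulIf prodE; apply: lt0r_neq0.
  by move: dnu => [_ h2 h3 h4]; rewrite !mulr_gt0 //; lra.
apply/rowP => k; have [k5|k5] := leqP 5 k; first by rewrite I1 // J1.
rewrite !coord8E; move: (nat_of_ord k) k5 => {k}.
by do 5![case=> //].
Qed.

Lemma dom_conjP mu : Wk_conj mu (dom_conj mu) /\ k_dominant (dom_conj mu).
Proof.
have [nu hnu] := dom_conj_exists mu.
exact: (@xgetPex _ mu [set nu | Wk_conj mu nu /\ k_dominant nu]%classic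
  (ex_intro _ nu hnu)).
Qed.

Definition highest_weight mu : Prop :=
  [/\ coord8 mu 7 = coord8 mu 6, coord8 mu 8 = - coord8 mu 6, k_dominant mu,
      forall i j : nat, (1 <= i <= 5)%N -> (1 <= j <= 5)%N ->
        coord8 mu i - coord8 mu j \is a Num.int &
      forall i : nat, (1 <= i <= 5)%N -> 2 * coord8 mu i \is a Num.int].

Definition schmid1 : 'rV[R]_8 :=
  2^-1 *: vec8 [:: 1; 1; 1; 1; 1; - 1; - 1; 1].

Definition schmid2 : 'rV[R]_8 := vec8 [:: 0; 0; 0; 0; 1; - 1; - 1; 1].

Definition schmid (a b : nat) : 'rV[R]_8 :=
  a%:R *: schmid1 + b%:R *: schmid2.

End Setting.

Arguments rho {R}.
Arguments schmid1 {R}.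
Arguments schmid2 {R}.
Arguments schmid {R} a b.

(* Main.v *)
Require Import Defs.
From HB Require Import structures.
From mathcomp Require Import all_boot all_order all_algebra.
From mathcomp Require Import zify ring lra.
From mathcomp Require Import boolp classical_sets reals.

Set Implicit Arguments.
Unset Strict Implicit.
Unset Printing Implicit Defensive.

Import Order.TTheory GRing.Theory Num.Theory.
Local Open Scope ring_scope.

(* The pairing <mu^+, rho> restricted to the first five coordinates equals the
   sum N(mu) of max(|mu_i|, |mu_j|) over i < j <= 5, a convex function of mu.
   Put D = N(lambda - s_1) - N(lambda) and
   S = lambda_1 + lambda_2 + lambda_3 + lambda_4.  Using the strict
   basic inequality to eliminate lambda_6, the claim for (a, b) reduces to
     N(lambda - s_{a,b}) - N(lambda) + a^2 - a + 2ab + 2b^2 - 2b + b S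
       >= (a + 2b) D.
   Convexity along s_1 and the fact that N is 4-Lipschitz in the fifth
   coordinate bound the difference of N from below by a D - 4b, so it is enough
   that D <= -1 together with S - 2 D >= 4.  The first always holds, and the
   second fails only at (-1/2, 1/2, 1/2, 1/2, 1/2), where only (a, b) = (0, 1)
   needs a separate computation. *)

(** * Sums of pairwise maxima: symmetry, convexity, Lipschitz and half-shift estimates *)

Section PairMax.
Variable R : realType.
Implicit Types (c : nat -> R) (x y a b : R).

Definition pairmax c : R :=
  \sum_(1 <= j < 6) \sum_(1 <= i < j) Num.max `|c i| `|c j|.

Lemma pairmaxE c : pairmax c =
  Num.max `|c 1%N| `|c 2| +
  (Num.max `|c 1%N| `|c 3| + Num.max `|c 2| `|c 3|) +
  (Num.max `|c 1%N| `|c 4| + Num.max `|c 2| `|c 4| + Num.max `|c 3| `|c 4|) +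
  (Num.max `|c 1%N| `|c 5| + Num.max `|c 2| `|c 5| + Num.max `|c 3| `|c 5| +
   Num.max `|c 4| `|c 5|).
Proof. by rewrite /pairmax unlock /=; ring. Qed.

Lemma eq_pairmax c c' :
  (forall i, (1 <= i <= 5)%N -> c i = c' i) -> pairmax c = pairmax c'.
Proof. by move=> e; rewrite !pairmaxE !e. Qed.

(** Writes [pairmax] as a symmetric function of the list of absolute values, so that permuting this
    list leaves it unchanged. The full double sum counts each pair twice and adds the diagonal. *)
Lemma pairmax_sum c (l := [seq `|c i| | i <- iota 1 5]) :
  2 * pairmax c = \sum_(x <- l) \sum_(y <- l) Num.max x y - \sum_(x <- l) x.
Proof.
rewrite pairmaxE /l /= !big_cons !big_nil !maxxx.
rewrite ![Num.max `|c 2| `|c 1%N|]maxC ![Num.max `|c 3| `|c 1%N|]maxC.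
rewrite ![Num.max `|c 4| `|c 1%N|]maxC ![Num.max `|c 5| `|c 1%N|]maxC.
rewrite ![Num.max `|c 3| `|c 2|]maxC ![Num.max `|c 4| `|c 2|]maxC.
rewrite ![Num.max `|c 5| `|c 2|]maxC ![Num.max `|c 4| `|c 3|]maxC.
by rewrite ![Num.max `|c 5| `|c 3|]maxC ![Num.max `|c 5| `|c 4|]maxC; ring.
Qed.

(** Triangle inequality for [a * (x - 2^-1) = (a - 1) * x + (x - a / 2)]: convexity along the shift,
    cleared of denominators. *)
Lemma norm_shift_convex x a : 1 <= a ->
  a * `|x - 2^-1| <= (a - 1) * `|x| + `|x - a / 2|.
Proof.
move=> a1; have a0 : 0 <= a - 1 by lra.
rewrite -[a in a * _]ger0_norm ?(le_trans _ a1) // -normrM.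
have -> : a * (x - 2^-1) = (a - 1) * x + (x - a / 2) by field.
by rewrite (le_trans (ler_normD _ _)) // normrM (ger0_norm a0).
Qed.

Lemma max_shift_convex x y a : 1 <= a ->
  a * Num.max `|x - 2^-1| `|y - 2^-1| <=
  (a - 1) * Num.max `|x| `|y| + Num.max `|x - a / 2| `|y - a / 2|.
Proof.
move=> a1; have a0 : 0 <= a - 1 by lra.
rewrite maxr_pMr ?(le_trans _ a1) // ge_max; apply/andP; split.
  apply: le_trans (norm_shift_convex x a1) (lerD _ _); last by rewrite le_max lexx.
  by rewrite ler_wpM2l // le_max lexx.
apply: le_trans (norm_shift_convex y a1) (lerD _ _); last by rewrite le_max lexx orbT.
by rewrite ler_wpM2l // le_max lexx orbT.
Qed.

Lemma pairmax_shift_convex c a : 1 <= a ->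
  a * pairmax (fun i => c i - 2^-1) <=
  (a - 1) * pairmax c + pairmax (fun i => c i - a / 2).
Proof.
move=> a1; rewrite /pairmax !mulr_sumr -big_split /=; apply: ler_sum => j _.
rewrite !mulr_sumr -big_split /=; apply: ler_sum => i _.
exact: max_shift_convex.
Qed.

Lemma max_norm_lipschitz x y b : 0 <= b ->
  Num.max `|x| `|y| - b <= Num.max `|x| `|y - b|.
Proof.
move=> b0; rewrite lerBlDr ge_max; apply/andP; split.
  by rewrite (@le_trans _ _ (`|x| + b)) ?lerDl // lerD2r le_max lexx.
apply: (@le_trans _ _ (`|y - b| + b)); last by rewrite lerD2r le_max lexx orbT.
by rewrite -{1}(subrK b y) (le_trans (ler_normD _ _)) // (ger0_norm b0).
Qed.

(** Only four pairs contain the index 5, and each loses at most [b]. *)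
Lemma pairmax_lipschitz c b : 0 <= b ->
  pairmax c - 4 * b <= pairmax (fun i => c i - (i == 5)%:R * b).
Proof.
move=> b0; rewrite !pairmaxE /= !mul0r !mul1r !subr0.
have := max_norm_lipschitz (c 1%N) (c 5) b0.
have := max_norm_lipschitz (c 2) (c 5) b0.
have := max_norm_lipschitz (c 3) (c 5) b0.
have := max_norm_lipschitz (c 4) (c 5) b0.
lra.
Qed.

Lemma max_half_shift_le x y :
  Num.max `|x - 2^-1| `|y - 2^-1| <= Num.max `|x| `|y| + 2^-1.
Proof.
have h : `|2^-1| = 2^-1 :> R by rewrite ger0_norm // invr_ge0.
rewrite ge_max; apply/andP; split; rewrite (le_trans (ler_normB _ _)) // h lerD2r.
  by rewrite le_max lexx.
by rewrite le_max lexx orbT.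
Qed.

Lemma int_gt0_ge1 x : x \is a Num.int -> 0 < x -> 1 <= x.
Proof. by move=> /intrP[m ->]; rewrite ltr0z ler1z gtz0_ge1. Qed.

(** Integrality excludes small values: if [x = 0] then [y] is a positive integer, and otherwise
    [x >= 1/2]. In both cases [y - 1/2] still dominates [|x - 1/2|]. *)
Lemma max_half_shift_eq x y : 0 <= x <= y -> 0 < y ->
  2 * x \is a Num.int -> y - x \is a Num.int ->
  Num.max `|x - 2^-1| `|y - 2^-1| = Num.max `|x| `|y| - 2^-1.
Proof.
move=> /andP[x0 xy] y0 ix iyx.
have [h1 h2] : 2^-1 <= y /\ `|x - 2^-1| <= y - 2^-1.
  have [xz|xn] := eqVneq x 0.
    have y1 : 1 <= y by apply: int_gt0_ge1 => //; rewrite -[y]subr0 -xz.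
    by split; [lra|rewrite xz ler_norml; apply/andP; split; lra].
  have x1 : 1 <= 2 * x.
    by apply: int_gt0_ge1 => //; rewrite pmulr_rgt0 // lt_neqAle eq_sym xn.
  by split; [lra|rewrite ler_norml; apply/andP; split; lra].
rewrite (ger0_norm x0) (ger0_norm (ltW y0)) (max_r xy).
by rewrite (@ger0_norm _ (y - _)) ?subr_ge0 // max_r.
Qed.

End PairMax.

(** * The shifted norm as a function invariant under the Weyl group *)

Section Energy.
Variable R : realType.
Implicit Types (mu nu : 'rV[R]_8).

(** A form of the squared norm of [dom_conj mu + rho] that avoids computing the dominant conjugate;
    78 is the squared norm of [rho]. *)
Definition energy mu : R :=
  dot mu mu + 2 * pairmax (coord8 mu)
  + 8 * (coord8 mu 8 - coord8 mu 6 - coord8 mu 7) + 78.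

Lemma dotE mu : dot mu mu =
  \sum_(x <- [seq `|coord8 mu i| | i <- iota 1 5]) x ^+ 2
  + coord8 mu 6 ^+ 2 + coord8 mu 7 ^+ 2 + coord8 mu 8 ^+ 2.
Proof.
rewrite /dot !big_ord_recl big_ord0 !coord8E /= !big_cons big_nil.
rewrite !real_normK ?num_real //; ring.
Qed.

Lemma norm8_sqr mu : norm8 mu ^+ 2 = dot mu mu.
Proof.
by rewrite sqr_sqrtr //; apply: sumr_ge0 => i _; rewrite -expr2 sqr_ge0.
Qed.

(** For dominant [mu] the maximum over a pair [i < j] is [coord8 mu j]. It occurs for [j - 1] values
    of [i], and [j - 1] is the [j]-th coordinate of [rho]. *)
Lemma norm8_dominant mu : k_dominant mu -> norm8 (mu + rho) ^+ 2 = energy mu.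
Proof.
move=> [h1 h2 h3 h4]; have h0 := normr_ge0 (coord8 mu 1).
rewrite norm8_sqr /energy pairmaxE.
rewrite (@ger0_norm _ (coord8 mu 2)); last lra.
rewrite (@ger0_norm _ (coord8 mu 3)); last lra.
rewrite (@ger0_norm _ (coord8 mu 4)); last lra.
rewrite (@ger0_norm _ (coord8 mu 5)); last lra.
rewrite !max_r; try lra.
by rewrite /dot !big_ord_recl !big_ord0 !mxE !coord8E /=; ring.
Qed.

Lemma Wk_conj_perm_abs mu nu : Wk_conj mu nu ->
  perm_eq [seq `|coord8 nu i| | i <- iota 1 5]
          [seq `|coord8 mu i| | i <- iota 1 5].
Proof.
move=> /conj_invariants[_ inv _]; apply/seq.permP => p.
have countE x : count p [seq `|coord8 x i| | i <- iota 1 5] =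
    (\sum_(k < 8 | k < 5) p `|x 0 k|%R)%N.
  by rewrite big_mkcond /= !big_ord_recl big_ord0 /= !coord8E.
by rewrite !countE; exact: (inv (fun r => p r)).
Qed.

Lemma energy_conj mu nu : Wk_conj mu nu -> energy nu = energy mu.
Proof.
move=> mn; have [inv _ _] := conj_invariants mn.
have coordE i : (5 <= i < 8)%N -> coord8 nu i.+1 = coord8 mu i.+1.
  by move=> i58; rewrite /coord8 inv //= inordK; lia.
have p := Wk_conj_perm_abs mn.
rewrite /energy !dotE !pairmax_sum !coordE // !(perm_big _ p) /=.
by congr (_ + (_ - _) + _ + _); apply: eq_bigr => x _; exact: perm_big.
Qed.

Lemma norm8_dom_conj mu : norm8 (dom_conj mu + rho) ^+ 2 = energy mu.
Proof.
by have [c d] := dom_conjP mu; rewrite norm8_dominant // (energy_conj c).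
Qed.

Lemma coord8_schmid mu (a b i : nat) : (1 <= i <= 5)%N ->
  coord8 (mu - schmid a b) i = coord8 mu i - a%:R / 2 - (i == 5)%:R * b%:R.
Proof.
move=> i15; rewrite /schmid /schmid1 /schmid2 /coord8 !mxE inordK; last lia.
by case: i i15 => [|[|[|[|[|[|i]]]]]] //= _; field.
Qed.

(** The sixth coordinate enters only with the coefficient [3 * (a + 2 * b)], so subtracting
    [a + 2 * b] times the case [(1, 0)] eliminates it. *)
Lemma energy_schmid mu (a b : nat) :
  coord8 mu 7 = coord8 mu 6 -> coord8 mu 8 = - coord8 mu 6 ->
  energy (mu - schmid a b) - energy mu =
    2 * a%:R ^+ 2 + 4 * a%:R * b%:R + 4 * b%:R ^+ 2
    + a%:R * (3 * (coord8 mu 6 - 4) - (coord8 mu 1 + coord8 mu 2 + coord8 mu 3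
                                       + coord8 mu 4 + coord8 mu 5))
    + 2 * b%:R * (3 * (coord8 mu 6 - 4) - coord8 mu 5)
    + 2 * (pairmax (fun i => coord8 mu i - a%:R / 2 - (i == 5)%:R * b%:R)
           - pairmax (coord8 mu)).
Proof.
move=> e7 e8; rewrite /energy (eq_pairmax (@coord8_schmid mu a b)) !dotE /=.
have [-> -> ->] : [/\ coord8 (mu - schmid a b) 6 = coord8 mu 6 + a%:R / 2 + b%:R,
    coord8 (mu - schmid a b) 7 = coord8 mu 7 + a%:R / 2 + b%:R &
    coord8 (mu - schmid a b) 8 = coord8 mu 8 - a%:R / 2 - b%:R].
  by split; rewrite /schmid /schmid1 /schmid2 /coord8 !mxE inordK //=; field.
rewrite !big_cons !big_nil !real_normK ?num_real // !coord8_schmid //=.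
by rewrite e7 e8; field.
Qed.

Lemma schmid10 : schmid 1 0 = schmid1 :> 'rV[R]_8.
Proof. by rewrite /schmid scale1r scale0r addr0. Qed.

End Energy.

(** * Estimates for highest weights *)

Section HighestWeight.
Variables (R : realType) (lambda : 'rV[R]_8).
Hypothesis lambda_hw : highest_weight lambda.
Hypothesis lambda_neq0 : (coord8 lambda 1, coord8 lambda 2,
                    coord8 lambda 3, coord8 lambda 4) <> (0, 0, 0, 0).
Let c := coord8 lambda.
Let S := c 1%N + c 2 + c 3 + c 4.
Let D := pairmax (fun i => c i - 2^-1) - pairmax c.

Lemma coord4_gt0 : 0 < c 4.
Proof.
have [_ _ [h1 h2 h3 _] _ _] := lambda_hw; rewrite -/c in h1 h2 h3.
have h0 := normr_ge0 (c 1%N).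
rewrite ltNge; apply/negP => c4; apply: lambda_neq0.
have c1 : c 1%N = 0 by apply/eqP; rewrite -normr_le0; lra.
by congr (_, _, _, _) => //; rewrite -/c; lra.
Qed.

Lemma half_shift_pair i j : (1 <= i <= 5)%N -> (1 <= j <= 5)%N ->
  0 <= c i <= c j -> 0 < c j ->
  Num.max `|c i - 2^-1| `|c j - 2^-1| = Num.max `|c i| `|c j| - 2^-1.
Proof.
have [_ _ _ d z] := lambda_hw => hi hj cij cj.
by apply: max_half_shift_eq => //; [exact: z|exact: d].
Qed.

(** The seven pairs containing 4 or 5 drop by 1/2 each, and the other three rise by at most 1/2
    each. *)
Lemma half_shift_nonneg : 0 <= c 1%N -> D <= - 2.
Proof.
have [_ _ [h1 h2 h3 h4] _ _] := lambda_hw; rewrite -/c in h1 h2 h3 h4.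
have c4 := coord4_gt0 => c1; rewrite ger0_norm // in h1.
rewrite /D !pairmaxE.
have E i j := @half_shift_pair i j.
rewrite (E 1%N 4) ?(E 2 4) ?(E 3 4) ?(E 1%N 5) ?(E 2 5) ?(E 3 5) ?(E 4 5) //;
  try (apply/andP; split); try lra.
have := max_half_shift_le (c 1%N) (c 2).
have := max_half_shift_le (c 1%N) (c 3).
have := max_half_shift_le (c 2) (c 3).
lra.
Qed.

(** The six pairs within 2, ..., 5 drop by 1/2 each, and the four pairs containing 1 rise by at most
    1/2 each. *)
Lemma half_shift_neg : c 1%N < 0 -> D <= - 1.
Proof.
have [_ _ [h1 h2 h3 h4] _ _] := lambda_hw; rewrite -/c in h1 h2 h3 h4.
move=> c1; rewrite ltr0_norm // in h1.
rewrite /D !pairmaxE.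
have E i j := @half_shift_pair i j.
rewrite (E 2 3) ?(E 2 4) ?(E 3 4) ?(E 2 5) ?(E 3 5) ?(E 4 5) //;
  try (apply/andP; split); try lra.
have := max_half_shift_le (c 1%N) (c 2).
have := max_half_shift_le (c 1%N) (c 3).
have := max_half_shift_le (c 1%N) (c 4).
have := max_half_shift_le (c 1%N) (c 5).
lra.
Qed.

Lemma half_shift_le : D <= - 1.
Proof.
have [c1|/half_shift_neg//] := leP 0 (c 1%N).
by have := half_shift_nonneg c1; lra.
Qed.

Lemma weight_cases : 4 <= S - 2 * D \/
  forall i, (1 <= i <= 5)%N -> c i = (-1) ^+ (i == 1%N) / 2.
Proof.
have [_ _ [h1 h2 h3 h4] d z] := lambda_hw; rewrite -/c in h1 h2 h3 h4 d z.
rewrite /S; have [c1|c1] := leP 0 (c 1%N).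
  by left; have := half_shift_nonneg c1; rewrite ger0_norm // in h1; lra.
have D1 := half_shift_neg c1; rewrite ltr0_norm // in h1.
have c1h : 1 <= - (2 * c 1%N).
  by apply: int_gt0_ge1; [rewrite rpredN; exact: z|lra].
(* Since [D <= - 1], [S >= 2] suffices. By integrality, [S < 2] forces the first four coordinates to
   be -1/2, 1/2, 1/2, 1/2. *)
have [|S2] := leP 2 (c 1%N + c 2 + c 3 + c 4); first by left; lra.
have gap i j : (1 <= i <= 5)%N -> (1 <= j <= 5)%N -> c i < c j -> c i + 1 <= c j.
  by move=> hi hj ij; have := int_gt0_ge1 (d j i hj hi); rewrite subr_gt0; lra.
have [c2|c2] := ltP 2^-1 (c 2).
  have : 1 <= 2 * c 2 - 1.
    by apply: int_gt0_ge1; [apply: rpredB; [exact: z|exact: rpred1]|lra].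
  lra.
have e2 : c 2 = 2^-1 by lra.
have e1 : c 1%N = - 2^-1 by lra.
have [/gap|c4] := ltP (c 2) (c 4); first by move=> /(_ isT isT); lra.
have e3 : c 3 = 2^-1 by lra.
have e4 : c 4 = 2^-1 by lra.
(* A fifth coordinate of at least 3/2 makes the pair (1, 5) drop too, which improves [D] to -2. *)
have [c5|c5] := ltP (c 4) (c 5).
  have {}c5 : 3 / 2 <= c 5 by have := gap 4 5 isT isT c5; lra.
  left; suff : D = - 2 by lra.
  have n x : 0 <= x -> `|x| = x :> R by exact: ger0_norm.
  have N x : x <= 0 -> `|x| = - x :> R by exact: ler0_norm.
  rewrite /D !pairmaxE e1 e2 e3 e4 subrr normr0 normrN.
  rewrite (N (- 2^-1 - 2^-1)) ?(n 2^-1) ?(n (c 5)) ?(n (c 5 - 2^-1)) ?maxxx; try lra.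
  rewrite !(@max_l _ _ (- _) 0) ?(@max_r _ _ _ (c 5)) ?(@max_r _ _ _ (c 5 - _));
    lra.
right=> i; have e5 : c 5 = 2^-1 by lra.
by case: i => [|[|[|[|[|[|i]]]]]] //= _; rewrite ?e1 ?e2 ?e3 ?e4 ?e5; lra.
Qed.

Lemma pairmax_schmid_ge (a b : nat) :
  (a%:R + 2 * b%:R) * D <=
  pairmax (fun i => c i - a%:R / 2 - (i == 5)%:R * b%:R) - pairmax c
    + a%:R ^+ 2 - a%:R + 2 * a%:R * b%:R + 2 * b%:R ^+ 2 - 2 * b%:R + b%:R * S.
Proof.
have D1 := half_shift_le.
have conv : pairmax c + a%:R * D <= pairmax (fun i => c i - a%:R / 2).
  case: a => [|a].
    rewrite mul0r addr0 le_eqVlt; apply/orP; left; apply/eqP/eq_pairmax => i _.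
    by rewrite mul0r subr0.
  have := pairmax_shift_convex c (ler1n R a.+1); rewrite /D; lra.
have lip := pairmax_lipschitz (fun i => c i - a%:R / 2) (ler0n R b).
have sq : 0 <= a%:R ^+ 2 - a%:R :> R.
  by rewrite expr2 -natrM subr_ge0 ler_nat; nia.
case: b lip => [|b] lip; first by move: lip conv; lra.
have b0 : 0 < b.+1%:R :> R by rewrite ltr0n.
(* What is left after the convexity bound and [a^2 >= a] has the factor [b.+1]; a bracket of at
   least 4 outweighs the Lipschitz loss. *)
suff : 0 <= pairmax (fun i => c i - a%:R / 2 - (i == 5)%:R * b.+1%:R)
    - pairmax (fun i => c i - a%:R / 2)
    + b.+1%:R * (2 * a%:R + 2 * b.+1%:R - 2 + S - 2 * D) by move: conv sq; lra.
have [SD|E] := weight_cases.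
  have : 0 <= b.+1%:R * (2 * a%:R + 2 * b.+1%:R - 2 + S - 2 * D - 4).
    apply: mulr_ge0; [exact: ltW|have := ler0n R a].
    have : 1 <= b.+1%:R :> R by rewrite ler1n.
    lra.
  by move: lip; lra.
have S1 : S = 1 by rewrite /S !E //= expr1 expr0; lra.
(* Here only [S - 2 * D >= 3] is known; the missing 1 comes from [2 * a + 2 * b.+1 - 2 >= 2]. *)
have [ab|] := leqP 2 (a + b.+1).
  have : 0 <= b.+1%:R * (2 * a%:R + 2 * b.+1%:R - 2 + S - 2 * D - 4).
    apply: mulr_ge0; [exact: ltW|move: ab].
    by rewrite -(ler_nat R) natrD; lra.
  by move: lip; lra.
case: a b {conv lip sq b0} => [|a] [|b]; try lia; move=> _.
(* The shift by [s_2] turns the fifth coordinate 1/2 into -1/2, so no absolute value changes. *)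
suff -> : pairmax (fun i => c i - 0%:R / 2 - (i == 5)%:R * 1%:R) =
  pairmax (fun i => c i - 0%:R / 2) by lra.
rewrite !pairmaxE /= !E //= !mul0r !mul1r !subr0.
by rewrite (_ : 2^-1 - 1 = - 2^-1 :> R) ?normrN //; lra.
Qed.

End HighestWeight.

(** * From the strict basic inequality to all Schmid modules *)

Theorem theorem2p5 (R : realType) (lambda : 'rV[R]_8)
    (lambda_hw : highest_weight lambda)
    (lambda_neq0 : (coord8 lambda 1, coord8 lambda 2,
                    coord8 lambda 3, coord8 lambda 4) <> (0, 0, 0, 0))
    (strict_basic : norm8 (dom_conj (lambda - schmid1) + rho) ^+ 2
                    > norm8 (lambda + rho) ^+ 2) :
  forall a b : nat, (a, b) <> (0%N, 0%N) ->
    norm8 (dom_conj (lambda - schmid a b) + rho) ^+ 2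
      - norm8 (lambda + rho) ^+ 2 > 0.
Proof.
move=> a b ab; have [e7 e8 dom _ _] := lambda_hw.
have := pairmax_schmid_ge lambda_hw lambda_neq0 a b.
move: strict_basic; rewrite -subr_gt0 -schmid10 !norm8_dom_conj norm8_dominant //.
rewrite !energy_schmid //.
rewrite (@eq_pairmax _ (fun i => _ - 1%:R / 2 - _)
  (fun i => coord8 lambda i - 2^-1)); last first.
  by move=> i _; rewrite mulr0 subr0 div1r.
move: (pairmax _) (pairmax _) (pairmax _) => N1 N0 Nab.
have ab0 : 0 < a%:R + 2 * b%:R :> R.
  rewrite -natrM -natrD ltr0n; case: a b ab => [|a] [|b] //.
(* The basic inequality, scaled by [a + 2 * b], is added to twice [pairmax_schmid_ge]. *)
rewrite -(pmulr_rgt0 _ ab0); lra.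
Qed.
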